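(* Let $2\le k<n$ be integers and let $G=([n],E,w)$ be a weighted graph with real edge weights and weight matrix $W\in\mathbb{S}^n$, where $W_{ij}=w_{ij}$ for $i\neq j$ (with $w_{ij}=0$ if $ij\notin E$) and $W_{ii}=0$. Let $Z\in\mathcal{Q}_{n,k}$ be a $k$-partition matrix, and define the active set $$\mathcal{A}(Z)=\left\{(i,j): i<j,\ Z_{ij}=-\frac{1}{k-1}\right\}.$$ Suppose there exist a diagonal matrix $D\in\mathbb{R}^{n\times n}$, a matrix $M\in\mathbb{S}^n$ with $M\succeq 0$, and scalars $\lambda_{ij}\ge 0$ for $(i,j)\in\mathcal{A}(Z)$ such that $$-W=D-M-\sum_{(i,j)\in\mathcal{A}(Z)}\lambda_{ij}E^{ij}\qquad\text{and}\qquad \langle M,Z\rangle=0.$$ Then $Z$ is an optimal solution of the Max-$k$-Cut SDP on $G$. In particular, the Max-$k$-Cut SDP on $G$ is exact.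
   Context: $[n]=\{1,\dots,n\}$. $\mathbb{S}^n$ is the space of real symmetric $n\times n$ matrices, $\langle A,B\rangle=\operatorname{tr}(AB)$, and $X\succeq0$ means $X$ is positive semidefinite. For $i<j$, $E^{ij}=\frac12(e_ie_j^\top+e_je_i^\top)$, where $e_i$ is the $i$-th standard basis vector. Max-$k$-Cut on $G$: partition $[n]$ into $k$ disjoint (possibly empty) parts $A_1,\dots,A_k$ so as to maximize $\operatorname{Cut}(A_1,\dots,A_k)=\sum_{\ell<m}\sum_{i\in A_\ell,\,j\in A_m}w_{ij}$. The $k$-partition matrix of a partition $(A_1,\dots,A_k)$ is the matrix $Z\in\mathbb{S}^n$ with $Z_{ij}=1$ if $i,j$ belong to the same part and $Z_{ij}=-\frac{1}{k-1}$ otherwise; $\mathcal{Q}_{n,k}$ is the set of all $k$-partition matrices. The Max-$k$-Cut SDP (Frieze--Jerrum relaxation) on $G$ is to maximize $\frac{k-1}{k}\sum_{i<j}w_{ij}(1-X_{ij})$ over $X\in\mathcal{L}_{n,k}$, where $\mathcal{L}_{n,k}=\{X\in\mathbb{S}^n: X_{ii}=1\ \forall i,\ X_{ij}\ge-\frac{1}{k-1}\ \forall i\ne j,\ X\succeq0\}$. The SDP is exact on $G$ if its optimal value equals the optimal value of Max-$k$-Cut on $G$. *)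

(* Defs.v *)
From mathcomp Require Import all_boot all_order all_algebra.
From mathcomp Require Import classical_sets reals constructive_ereal ereal.

Set Implicit Arguments.
Unset Strict Implicit.
Unset Printing Implicit Defensive.

Import Order.TTheory GRing.Theory Num.Theory.
Local Open Scope ring_scope.

(** The vertex set [n] is 'I_n, i.e. vertices are numbered from 0. *)

Definition frob (R : realType) (n : nat) (A B : 'M[R]_n) : R := \tr (A *m B).

Definition psdmx (R : realType) (n : nat) (M : 'M[R]_n) : Prop :=
  M \is symmetricmx /\
  forall x : 'cV[R]_n, 0 <= (x^T *m M *m x) ord0 ord0.

Definition std_basis (R : realType) (n : nat) (i : 'I_n) : 'cV[R]_n :=
  delta_mx i ord0.

Definition Emx (R : realType) (n : nat) (i j : 'I_n) : 'M[R]_n :=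
  2^-1 *: (std_basis R i *m (std_basis R j)^T
           + std_basis R j *m (std_basis R i)^T).

(** The weight is a total function, extended by 0 outside the edge set; as
    edges are irreflexive, the weight matrix has zero diagonal. *)
Record wgraph (R : realType) (n : nat) := WGraph {
  edge : rel 'I_n;
  weight : 'I_n -> 'I_n -> R;
  edge_sym : symmetric edge;
  edge_irr : irreflexive edge;
  weight_sym : forall i j, weight i j = weight j i;
  weight_nonedge : forall i j, ~~ edge i j -> weight i j = 0
}.

Definition weight_mx (R : realType) (n : nat) (G : wgraph R n) : 'M[R]_n :=
  \matrix_(i, j) weight G i j.

(** Parts may be empty, so [finset.partition] does not apply. *)
Definition is_kpartition (n k : nat) (A : 'I_k -> {set 'I_n}) : Prop :=
  (forall l m, l != m -> [disjoint A l & A m]) /\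
  \bigcup_(l < k) A l = [set: 'I_n].

Definition cut (R : realType) (n k : nat) (G : wgraph R n)
    (A : 'I_k -> {set 'I_n}) : R :=
  \sum_(l < k) \sum_(m < k | (l < m)%N)
    \sum_(i in A l) \sum_(j in A m) weight G i j.

Definition off_value (R : realType) (k : nat) : R := - (1 / (k%:R - 1)).

Definition kpartition_mx (R : realType) (n k : nat)
    (A : 'I_k -> {set 'I_n}) : 'M[R]_n :=
  \matrix_(i, j)
    if [exists l, (i \in A l) && (j \in A l)] then 1 else off_value R k.

Definition kpartition_mxs (R : realType) (n k : nat) : set 'M[R]_n :=
  [set Z | exists A : 'I_k -> {set 'I_n},
             is_kpartition A /\ Z = kpartition_mx R A]%classic.

Arguments kpartition_mxs R n k : clear implicits.

Definition active (R : realType) (n k : nat) (Z : 'M[R]_n) :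
    {set 'I_n * 'I_n} :=
  [set p : 'I_n * 'I_n
     | (p.1 < p.2)%N && (Z p.1 p.2 == off_value R k)].

Definition sdp_feasible (R : realType) (n k : nat) : set 'M[R]_n :=
  [set X | [/\ X \is symmetricmx,
               forall i, X i i = 1,
               forall i j, i != j -> off_value R k <= X i j
             & psdmx X]]%classic.

Arguments sdp_feasible R n k : clear implicits.

Definition sdp_objective (R : realType) (n k : nat) (G : wgraph R n)
    (X : 'M[R]_n) : R :=
  (k%:R - 1) / k%:R *
  \sum_(i < n) \sum_(j < n | (i < j)%N) weight G i j * (1 - X i j).

Definition sdp_optimal (R : realType) (n k : nat) (G : wgraph R n)
    (Z : 'M[R]_n) : Prop :=
  sdp_feasible R n k Z /\
  forall X, sdp_feasible R n k X -> sdp_objective k G X <= sdp_objective k G Z.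

(** Optimal values are suprema in the extended reals, so that no attainment
    or boundedness is presupposed. *)
Definition maxkcut_value (R : realType) (n k : nat) (G : wgraph R n) : \bar R :=
  ereal_sup
    [set (cut G A)%:E
      | A in [set A : 'I_k -> {set 'I_n} | is_kpartition A]]%classic.

Definition sdp_value (R : realType) (n k : nat) (G : wgraph R n) : \bar R :=
  ereal_sup [set (sdp_objective k G X)%:E | X in sdp_feasible R n k]%classic.

Definition sdp_exact (R : realType) (n k : nat) (G : wgraph R n) : Prop :=
  sdp_value k G = maxkcut_value k G.

(* Main.v *)
(** Trace duality: for every feasible X the certificate gives
    <-W, X> = tr D - <M, X> - sum lam_ij X_ij
            <= tr D + (1/(k-1)) sum lam_ij,
    because <M, X> >= 0, with equality at X = Z.  Exactness follows since
    the objective at a partition matrix is the value of the cut. *)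

Require Import Defs.
From mathcomp Require Import all_boot all_order all_algebra.
From mathcomp Require Import classical_sets reals constructive_ereal ereal.
From mathcomp Require Import ring lra.

Set Implicit Arguments.
Unset Strict Implicit.
Unset Printing Implicit Defensive.

Import Order.TTheory GRing.Theory Num.Theory.
Local Open Scope ring_scope.

(** * Quadratic forms of symmetric matrices *)

Lemma symmetricmx_trP (R : fieldType) (n : nat) (M : 'M[R]_n) :
  reflect (M^T = M) (M \is symmetricmx).
Proof.
by apply: (iffP (is_hermitianmxP _ _ _)); rewrite expr0 scale1r map_mx_id.
Qed.

(** The two cross terms merge: each is a 1 by 1 matrix, and transposing one gives the other because
    M is symmetric. *)
Lemma qformDl (R : comNzRingType) (n : nat) (M : 'M[R]_n) (x y : 'cV[R]_n)
    (c : R) : M^T = M ->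
  ((x + c *: y)^T *m M *m (x + c *: y)) ord0 ord0 =
  (x^T *m M *m x) ord0 ord0 + 2 * c * (x^T *m M *m y) ord0 ord0
  + c ^+ 2 * (y^T *m M *m y) ord0 ord0.
Proof.
move=> symM.
have yMx : (y^T *m M *m x) ord0 ord0 = (x^T *m M *m y) ord0 ord0.
  by rewrite -[in LHS](trmxK (y^T *m M *m x)) mxE !trmx_mul trmxK symM mulmxA.
have -> : (x + c *: y)^T = x^T + c *: y^T by rewrite linearD linearZ.
rewrite !mulmxDl !mulmxDr -!scalemxAl -!scalemxAr.
rewrite !mxE in yMx *; rewrite yMx; ring.
Qed.

Lemma form_delta (R : comNzRingType) (n : nat) (M : 'M[R]_n) (i j : 'I_n) :
  ((delta_mx i ord0 : 'cV[R]_n)^T *m M *m (delta_mx j ord0 : 'cV[R]_n))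
    ord0 ord0 = M i j.
Proof. by rewrite trmx_delta -rowE -colE !mxE. Qed.

(** * Nonnegativity of the inner product on the positive semidefinite cone *)

Section Psd.
Variables (R : realType) (n : nat).
Implicit Types M X : 'M[R]_n.

Lemma psdmx_diag_ge0 X i : psdmx X -> 0 <= X i i.
Proof. by case=> _ /(_ (delta_mx i ord0)); rewrite form_delta. Qed.

(** With a zero diagonal, the form at e_i + e_j is 2 X_ij and at e_i - e_j it is -2 X_ij; both are
    nonnegative. *)
Lemma psdmx_diag0 X : psdmx X -> (forall i, X i i = 0) -> X = 0.
Proof.
move=> [/symmetricmx_trP symX X_ge0] X0; apply/matrixP => i j; rewrite [RHS]mxE.
have := X_ge0 (delta_mx i ord0 + 1 *: delta_mx j ord0).
have := X_ge0 (delta_mx i ord0 + (- 1) *: delta_mx j ord0).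
rewrite !qformDl // !form_delta !X0; lra.
Qed.

(** Schur complement of the entry X_ii, kept at size n so that the induction stays inside one matrix
    type. *)
Definition schur_step X i : 'M[R]_n :=
  X - (X i i)^-1 *: (col i X *m (col i X)^T).

Lemma schur_stepE X i a b :
  schur_step X i a b = X a b - (X i i)^-1 * (X a i * X b i).
Proof. by rewrite !mxE big_ord1 !mxE. Qed.

(** Completing the square: the form of the Schur step at x is the minimum over t of the form of X at
    x + t e_i, reached at t = - b / X_ii. *)
Lemma psdmx_schur_step X i : psdmx X -> X i i != 0 -> psdmx (schur_step X i).
Proof.
move=> [/symmetricmx_trP symX X_ge0] Xi0; split.
  apply/symmetricmx_trP/matrixP => a b; rewrite mxE !schur_stepE.
  by rewrite -[in X b a]symX mxE [X b i * _]mulrC.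
move=> x; pose b := (x^T *m X *m (delta_mx i ord0 : 'cV[R]_n)) ord0 ord0.
have := X_ge0 (x + (- (b / X i i)) *: delta_mx i ord0).
rewrite qformDl // form_delta -/b; congr (0 <= _).
have xv : x^T *m col i X = b%:M by rewrite colE mulmxA; exact: mx11_scalar.
have vx : (col i X)^T *m x = b%:M.
  by rewrite -[LHS]trmxK trmx_mul trmxK xv tr_scalar_mx.
rewrite /schur_step mulmxBr mulmxBl -scalemxAr -scalemxAl mulmxA.
rewrite -[X in _ - _ *: X]mulmxA xv vx -scalar_mxM !mxE eqxx mulr1n.
by field.
Qed.

(* Each Schur step subtracts a rank-one term v v^T / X_ii, which contributes
   v^T M v / X_ii >= 0 to the trace, and kills a diagonal entry for good. *)
Lemma frob_psd_ge0 M X : psdmx M -> psdmx X -> 0 <= frob M X.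
Proof.
move=> psdM; move: {2}_.+1 (ltnSn #|[set i | X i i != 0]|) => m.
elim: m X => // m IH X; rewrite ltnS => leXm psdX.
have [/forallP X0|/forallPn[i Xi0]] := boolP [forall i, X i i == 0].
  rewrite (psdmx_diag0 psdX) => [|i]; last exact/eqP.
  by rewrite /frob mulmx0 mxtrace0.
have psdX' := psdmx_schur_step psdX Xi0.
have -> : X = schur_step X i + (X i i)^-1 *: (col i X *m (col i X)^T).
  by rewrite subrK.
rewrite /frob mulmxDr mxtraceD -scalemxAr mxtraceZ mulmxA.
rewrite [X in _ + _ * X]mxtrace_mulC mulmxA trace_mx11; apply: addr_ge0; last first.
  apply: mulr_ge0; first by rewrite invr_ge0 psdmx_diag_ge0.
  by case: psdM => _; apply.
apply: IH => //; apply: leq_trans leXm; apply: proper_card.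
apply/properP; split; last first.
  by exists i; rewrite !inE // schur_stepE mulKf // subrr eqxx.
(* No new nonzero diagonal entry appears: if X_jj = 0, the new entry is - X_ji^2 / X_ii,
   nonpositive, yet nonnegative on the diagonal of a psd matrix. *)
apply/fintype.subsetP => j; rewrite !inE; apply: contraNneq => Xj0.
rewrite eq_le psdmx_diag_ge0 // andbT schur_stepE Xj0 sub0r oppr_le0.
by rewrite mulr_ge0 ?invr_ge0 ?psdmx_diag_ge0 // -expr2 sqr_ge0.
Qed.

End Psd.

(** * Inner products by entries and sums over pairs *)

Lemma frobE (R : realType) (n : nat) (A X : 'M[R]_n) : X^T = X ->
  frob A X = \sum_i \sum_j A i j * X i j.
Proof.
move=> symX; apply: eq_bigr => i _; rewrite mxE; apply: eq_bigr => j _.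
by rewrite -[in LHS]symX mxE.
Qed.

Lemma frob_Emx (R : realType) (n : nat) (X : 'M[R]_n) i j : X^T = X ->
  frob (Emx R i j) X = X i j.
Proof.
move=> symX; rewrite /frob /Emx /std_basis -scalemxAl mulmxDl mxtraceZ mxtraceD.
rewrite -!mulmxA ![\tr (delta_mx _ _ *m _)]mxtrace_mulC !trace_mx11 !form_delta.
have -> : X j i = X i j by rewrite -[in LHS]symX mxE.
by field.
Qed.

(** Swapping i and j exchanges the pairs with f i < f j and those with f i > f j. The identity as f
    serves the SDP objective, a labelling by parts serves the cut. *)
Lemma sum_lt_sym (R : nmodType) (n k : nat) (f : 'I_n -> 'I_k)
    (g : 'I_n -> 'I_n -> R) : (forall i j, g i j = g j i) ->
  (\sum_i \sum_(j | (f i < f j)%N) g i j) *+ 2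
  = \sum_i \sum_(j | f i != f j) g i j.
Proof.
move=> symg; rewrite mulr2n.
under [in RHS]eq_bigr => i _.
  rewrite (bigID (fun j => (f i < f j)%N)) /=.
  over.
rewrite big_split /=; congr (_ + _).
  apply: eq_bigr => i _; apply: eq_bigl => j.
  by rewrite -val_eqE /=; case: ltngtP.
rewrite pair_big_dep [RHS]pair_big_dep (reindex (fun p => (p.2, p.1))) /=.
  apply: eq_big => [[i j]|[i j] _] /=; last exact: symg.
  by rewrite -val_eqE /=; case: ltngtP.
by exists (fun p => (p.2, p.1)) => -[].
Qed.

(** * Partition matrices, cuts and the SDP objective *)

Section Partition.
Variables (R : realType) (n k : nat).
Hypothesis hk : (2 <= k)%N.
Implicit Types (f : 'I_n -> 'I_k) (A : 'I_k -> {set 'I_n}).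

(** Covering gives each vertex a part and disjointness makes it unique, so the parts are the fibres
    of f; empty parts are labels that f misses. *)
Lemma kpartition_label A : is_kpartition A ->
  exists f, forall i l, (i \in A l) = (f i == l).
Proof.
move=> [disjA coverA].
have ex i : exists l, i \in A l.
  have : i \in \bigcup_(l < k) A l by rewrite coverA inE.
  by case/bigcupP => l _; exists l.
exists (fun i => xchoose (ex i)) => i l; have := xchooseP (ex i).
set m := xchoose _ => Aim; apply/idP/eqP => [Ail|<- //].
apply: contraTeq Ail => /disjA dml; by rewrite (disjointFr dml Aim).
Qed.

Lemma kpartition_mx_label A f : (forall i l, (i \in A l) = (f i == l)) ->
  kpartition_mx R A = \matrix_(i, j) (if f i == f j then 1 else off_value R k).
Proof.
move=> Af; apply/matrixP => i j; rewrite !mxE; congr (if _ then _ else _).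
apply/existsP/eqP => [[l]|fij]; last by exists (f i); rewrite !Af fij eqxx.
by rewrite !Af => /andP[/eqP-> /eqP->].
Qed.

Lemma kM1_gt0 : 0 < k%:R - 1 :> R.
Proof. by rewrite subr_gt0 ltr1n. Qed.

Lemma k_neq0 : k%:R != 0 :> R.
Proof. by rewrite pnatr_eq0 -lt0n ltnW. Qed.

(* With class sums s_l of x, (k-1) x^T Z x = k sum s_l^2 - (sum s_l)^2, and
   Lagrange's identity writes this as half of sum_{l,m} (s_l - s_m)^2. *)
Lemma psdmx_label f :
  psdmx (\matrix_(i, j) (if f i == f j then 1 else off_value R k) : 'M[R]_n).
Proof.
have k1 := kM1_gt0; split.
  by apply/symmetricmx_trP/matrixP => i j; rewrite !mxE eq_sym.
move=> x; pose s l := \sum_(i | f i == l) x i ord0.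
(* A kernel that depends on labels only lets the double sum over vertices collapse to class sums. *)
have sE (h : 'I_k -> 'I_k -> R) :
    \sum_i \sum_j x i ord0 * h (f i) (f j) * x j ord0
    = \sum_l \sum_m h l m * (s l * s m).
  rewrite (partition_big f predT) //=; apply: eq_bigr => l _.
  rewrite exchange_big (partition_big f predT) //=; apply: eq_bigr => m _.
  rewrite /s mulr_suml mulr_sumr exchange_big /=.
  apply: eq_bigr => i /eqP fi; rewrite mulr_sumr mulr_sumr.
  by apply: eq_bigr => j /eqP fj; rewrite fi fj; ring.
have -> : (x^T *m (\matrix_(i, j) (if f i == f j then 1 else off_value R k))
             *m x) ord0 ord0
    = \sum_l \sum_m (if l == m then 1 else off_value R k) * (s l * s m).
  rewrite -sE mxE exchange_big /=; apply: eq_bigr => j _.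
  rewrite mxE mulr_suml; apply: eq_bigr => i _; by rewrite !mxE.
have -> : \sum_l \sum_m (if l == m then 1 else off_value R k) * (s l * s m)
    = (2 * (k%:R - 1))^-1 * \sum_l \sum_m (s l - s m) ^+ 2.
  pose Q := \sum_l s l ^+ 2; pose P := \sum_l \sum_m s l * s m.
  have -> : \sum_l \sum_m (s l - s m) ^+ 2 = 2 * (k%:R * Q - P).
    transitivity (\sum_l (k%:R * s l ^+ 2 + Q - 2 * \sum_m s l * s m)).
      apply: eq_bigr => l _; rewrite mulr_sumr -sumrN.
      rewrite -[in k%:R](card_ord k) mulr_natl -sumr_const /Q -!big_split /=.
      by apply: eq_bigr => m _; ring.
    rewrite !big_split /= sumrN -!mulr_sumr sumr_const card_ord -mulr_natl.
    by rewrite -/Q -/P; ring.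
  (* With c = [off_value R k], the kernel is c everywhere plus 1 - c = k / (k - 1) on the
     diagonal. *)
  transitivity (\sum_l ((1 - off_value R k) * s l ^+ 2
                        + off_value R k * \sum_m s l * s m)).
    apply: eq_bigr => l _; rewrite (bigD1 l) //= eqxx [in RHS](bigD1 l) //=.
    rewrite mulrDr addrA [X in _ = _ + X]mulr_sumr; congr (_ + _); first by ring.
    by apply: eq_bigr => m /negbTE; rewrite eq_sym => ->.
  rewrite big_split /= -!mulr_sumr -/Q -/P /off_value.
  by field; rewrite gt_eqF.
apply: mulr_ge0; first by rewrite invr_ge0 mulr_ge0 // ltW.
by apply: sumr_ge0 => l _; apply: sumr_ge0 => m _; exact: sqr_ge0.
Qed.

Lemma off_value_le1 : off_value R k <= 1.
Proof.
apply: (@le_trans _ _ 0) => //.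
by rewrite oppr_le0 divr_ge0 // ltW // kM1_gt0.
Qed.

Lemma kpartition_mx_feasible A : is_kpartition A ->
  sdp_feasible R n k (kpartition_mx R A).
Proof.
move=> /kpartition_label[f Af]; rewrite (kpartition_mx_label Af).
have psdZ := psdmx_label f; split => //; first by case: psdZ.
- by move=> i; rewrite mxE eqxx.
- by move=> i j _; rewrite mxE; case: ifP => // _; exact: off_value_le1.
Qed.

Variable G : wgraph R n.

(** The full double sum counts each pair twice, and its diagonal vanishes because there are no
    loops. Maximizing the objective thus means minimizing the inner product of W and X. *)
Lemma sdp_objectiveE (X : 'M[R]_n) : X^T = X ->
  sdp_objective k G X =
  (k%:R - 1) / k%:R / 2 * (\sum_i \sum_j weight G i j - frob (weight_mx G) X).
Proof.
move=> symX; rewrite /sdp_objective.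
have symg i j : weight G i j * (1 - X i j) = weight G j i * (1 - X j i).
  by rewrite weight_sym -[in LHS]symX mxE.
have /= sumE := sum_lt_sym id symg.
have -> : \sum_i \sum_j weight G i j - frob (weight_mx G) X
    = 2 * \sum_(i < n) \sum_(j < n | (i < j)%N) weight G i j * (1 - X i j).
  rewrite mulr_natl sumE (frobE _ symX) -sumrB; apply: eq_bigr => i _.
  rewrite -sumrB [LHS](bigD1 i) //= !mxE weight_nonedge ?edge_irr //.
  rewrite mul0r subr0 add0r; apply: eq_big => j; first by rewrite eq_sym.
  by move=> _; rewrite mxE mulrBr mulr1.
have := k_neq0 => k0; by field.
Qed.

Lemma cut_label A f : (forall i l, (i \in A l) = (f i == l)) ->
  cut G A = \sum_i \sum_(j | (f i < f j)%N) weight G i j.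
Proof.
move=> Af; rewrite [RHS](partition_big f predT) //=; apply: eq_bigr => l _.
rewrite exchange_big /=; apply: eq_big => [i|i]; rewrite Af // => /eqP fi.
rewrite [RHS](partition_big f (fun m => l < m)%N) => [|j]; last by rewrite fi.
apply: eq_bigr => m lm; apply: eq_bigl => j.
by rewrite Af fi; case: eqP => [->|]; rewrite ?lm ?andbF.
Qed.

(** 1 - Z_ij is 0 inside a part and k / (k - 1) across parts, which the prefactor (k - 1) / k
    cancels. *)
Lemma cut_sdp_objective A : is_kpartition A ->
  cut G A = sdp_objective k G (kpartition_mx R A).
Proof.
move=> /kpartition_label[f Af]; have k1 := kM1_gt0; have k0 := k_neq0.
have /sum_lt_sym symf : forall i j, weight G i j = weight G j i.
  exact: weight_sym.
have [/symmetricmx_trP symZ _] := psdmx_label f.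
rewrite (kpartition_mx_label Af) sdp_objectiveE // frobE // -sumrB.
rewrite (cut_label Af); have cutE := symf _ f.
have -> : \sum_i (\sum_j weight G i j - \sum_j weight_mx G i j *
      (\matrix_(i, j) (if f i == f j then 1 else off_value R k)) i j)
    = k%:R / (k%:R - 1) * \sum_i \sum_(j | f i != f j) weight G i j.
  rewrite mulr_sumr; apply: eq_bigr => i _.
  rewrite -sumrB mulr_sumr [RHS]big_mkcond /=; apply: eq_bigr => j _.
  rewrite !mxE; case: eqP => _ /=; first by ring.
  by rewrite /off_value; field; rewrite gt_eqF.
by rewrite -cutE -mulr_natl; field; rewrite k0 gt_eqF.
Qed.

(** * The dual certificate *)

Section Certificate.
Variables (Z D M : 'M[R]_n) (lam : 'I_n * 'I_n -> R).
Hypothesis diagD : is_diag_mx D.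
Hypothesis certE :
  - weight_mx G = D - M - \sum_(p in active k Z) lam p *: Emx R p.1 p.2.

(** The unit diagonal of X reduces its inner product with D to the trace of D, the same constant for
    X and for Z. *)
Lemma frob_certificate X : X^T = X -> (forall i, X i i = 1) ->
  frob (weight_mx G) X
  = frob M X - \tr D + \sum_(p in active k Z) lam p * X p.1 p.2.
Proof.
move=> symX X1.
have -> : weight_mx G = M - D + \sum_(p in active k Z) lam p *: Emx R p.1 p.2.
  by rewrite -[weight_mx G]opprK certE !opprB addrC.
rewrite {1}/frob mulmxDl mulmxBl mxtraceD raddfB /=; congr (_ - _ + _).
  have /diag_mxP[d ->] := diagD.
  apply: eq_bigr => i _; by rewrite mul_diag_mx !mxE X1 eqxx mulr1n mulr1.
rewrite mulmx_suml raddf_sum; apply: eq_bigr => p _ /=.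
by rewrite -scalemxAl mxtraceZ -/(frob _ _) frob_Emx.
Qed.

Hypothesis psdM : psdmx M.
Hypothesis lam_ge0 : forall p, p \in active k Z -> 0 <= lam p.
Hypothesis MZ0 : frob M Z = 0.

Lemma certificate_optimal : sdp_feasible R n k Z -> sdp_optimal k G Z.
Proof.
move=> feasZ; split => // X [/symmetricmx_trP symX X1 Xoff psdX].
case: feasZ => /symmetricmx_trP symZ Z1 _ _.
rewrite !sdp_objectiveE //; apply: ler_wpM2l.
  by rewrite !divr_ge0 ?ler0n // ltW // kM1_gt0.
rewrite lerD2l lerN2 !frob_certificate // MZ0 sub0r; apply: lerD.
  by rewrite lerDr; exact: frob_psd_ge0.
(* On active pairs Z attains the lower bound that feasibility imposes on X. *)
apply: ler_sum => p pZ; apply: ler_wpM2l; first exact: lam_ge0.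
move: pZ; rewrite inE => /andP[lt12 /eqP->]; apply: Xoff.
by rewrite -val_eqE /= ltn_eqF.
Qed.

End Certificate.

(** The SDP maximum is attained at Z, where it is the value of a cut; conversely every cut value is
    the objective of a feasible matrix. *)
Lemma optimal_kpartition_exact Z :
  kpartition_mxs R n k Z -> sdp_optimal k G Z -> sdp_exact k G.
Proof.
move=> [A [partA ZE]] [feasZ optZ]; apply/eqP; rewrite eq_le; apply/andP; split.
  apply: ge_ereal_sup => _ [X feasX <-].
  apply: (@le_trans _ _ (cut G A)%:E).
    by rewrite lee_fin cut_sdp_objective // -ZE; exact: optZ.
  by apply: ereal_sup_ubound; exists A.
apply: ge_ereal_sup => _ [B partB <-]; apply: ereal_sup_ubound.
exists (kpartition_mx R B); first exact: kpartition_mx_feasible.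
by rewrite cut_sdp_objective.
Qed.

End Partition.

Theorem theorem4 (R : realType) (n k : nat) (hk : (2 <= k)%N) (hkn : (k < n)%N)
    (G : wgraph R n) (Z : 'M[R]_n) (hZ : kpartition_mxs R n k Z)
    (hcert : exists (D M : 'M[R]_n) (lam : 'I_n * 'I_n -> R),
       [/\ is_diag_mx D,
           psdmx M,
           forall p, p \in active k Z -> 0 <= lam p,
           - weight_mx G
             = D - M - \sum_(p in active k Z) lam p *: Emx R p.1 p.2
         & frob M Z = 0]) :
  sdp_optimal k G Z /\ sdp_exact k G.
Proof.
have [A [partA ZE]] := hZ.
have [D [M [lam [diagD psdM lam_ge0 certE MZ0]]]] := hcert.
have optZ : sdp_optimal k G Z.
  apply: (certificate_optimal hk diagD certE psdM lam_ge0 MZ0).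
  by rewrite ZE; exact: kpartition_mx_feasible.
by split => //; exact: optimal_kpartition_exact optZ.
Qed.
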